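(* Let $\{P_n(x)\}_{n=0}^{\infty}$ be the monic orthogonal polynomial sequence with respect to a symmetric measure $\mu$ on $\mathbb{R}$ with finite moments, supported on a symmetric, infinite subset of $\mathbb{R}$, and let $c>0$. Let $\{t_n\}_{n=0}^{\infty}$ be a sequence of real numbers with $t_0=t_1=0$ and $t_n\neq 0$ for $n\ge 2$, and define the quasi-orthogonal polynomials $Q_n(x):=P_n(x)+t_nP_{n-2}(x)$, $n\ge 0$. Then $\{Q_n(x)\}_{n=0}^{\infty}$ is a monic orthogonal polynomial sequence with respect to $\frac{d\mu(x)}{c+x^2}$ if and only if for all $n\ge 2$ $$t_n=\begin{cases}\dfrac{-\int_{-\infty}^{\infty}P_n(x)\frac{d\mu(x)}{c+x^2}}{\int_{-\infty}^{\infty}P_{n-2}(x)\frac{d\mu(x)}{c+x^2}}, & n\text{ even},\\[3ex] \dfrac{-\int_{-\infty}^{\infty}xP_n(x)\frac{d\mu(x)}{c+x^2}}{\int_{-\infty}^{\infty}xP_{n-2}(x)\frac{d\mu(x)}{c+x^2}}, & n\text{ odd}.\end{cases}$$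
   Context: Measures are (non-negative) measures on $\mathbb{R}$; $\mu$ is symmetric if it is invariant under $x\mapsto -x$. A sequence of real polynomials $\{P_n(x)\}_{n=0}^{\infty}$ is an orthogonal polynomial sequence (OPS) with respect to a measure $\nu$ if $\deg P_n=n$ for all $n\geq 0$, $\int P_nP_m\,d\nu=0$ for $n\ne m$, and $\int P_n^2\,d\nu\neq 0$ for all $n$. It is monic if every $P_n$ has leading coefficient $1$. Convention: $P_{-1}=P_{-2}=0$, so $Q_0=P_0$ and $Q_1=P_1$. *)

(* Defs.v *)
From HB Require Import structures.
From mathcomp Require Import all_boot all_order all_algebra.
From mathcomp Require Import all_classical all_reals all_analysis.
From mathcomp Require Import measurable_realfun.

Set Implicit Arguments.
Unset Strict Implicit.
Unset Printing Implicit Defensive.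

Import Order.TTheory GRing.Theory Num.Theory.
Import numFieldNormedType.Exports.

Local Open Scope classical_set_scope.
Local Open Scope ring_scope.

Section borel_measures.
Context {R : realType}.
Implicit Type mu : {measure set (measurableTypeR R) -> \bar R}.

Definition symmetric_measure mu : Prop :=
  forall A : set (measurableTypeR R), measurable A -> mu (-%R @^-1` A) = mu A.

Definition finite_moments mu : Prop :=
  forall n : nat, mu.-integrable setT (fun x : R => (x ^+ n)%:E).

Definition measure_support mu : set R :=
  [set x | forall U : set R, open U -> U x -> (0 < mu U)%E].

Definition symmetric_set (S : set R) : Prop := forall x, S x -> S (- x).

(* The measure dmu(x) / (c + x^2); positivity of c makes the density
   nonnegative and continuous. *)
Definition over_quadratic mu (c : R) (c_gt0 : 0 < c)
    (A : set (measurableTypeR R)) : \bar R :=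
  (\int[mu]_(x in A) ((c + x ^+ 2)^-1)%:E)%E.

Section over_quadratic_measure.
Variables (mu : {measure set (measurableTypeR R) -> \bar R}).
Variables (c : R) (c_gt0 : 0 < c).

Let den_gt0 (x : R) : 0 < c + x ^+ 2.
Proof. by rewrite ltr_pwDl// sqr_ge0. Qed.

Let density_ge0 (x : R) : (0 <= ((c + x ^+ 2)^-1)%:E)%E.
Proof. by rewrite lee_fin invr_ge0 ltW. Qed.

Let measurable_density :
  measurable_fun setT
    ((fun x => ((c + x ^+ 2)^-1)%:E) : measurableTypeR R -> \bar R).
Proof.
apply/measurable_EFinP.
have cw : continuous (fun x : R => (c + x ^+ 2)^-1).
  move=> x; apply: cvgV; first by rewrite gt_eqF.
  by apply: cvgD; [exact: cvg_cst | exact: exprn_continuous].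
exact: continuous_measurable_fun cw.
Qed.

Let over_quadratic0 : over_quadratic mu c_gt0 set0 = 0%E.
Proof. exact: integral_set0. Qed.

Let over_quadratic_ge0 A : (0 <= over_quadratic mu c_gt0 A)%E.
Proof. by apply: integral_ge0 => x _; exact: density_ge0. Qed.

Let over_quadratic_sigma_additive :
  semi_sigma_additive (over_quadratic mu c_gt0).
Proof.
by apply: semi_sigma_additive_nng_induced => // x; exact: density_ge0.
Qed.

HB.instance Definition _ := isMeasure.Build _ _ _ (over_quadratic mu c_gt0)
  over_quadratic0 over_quadratic_ge0 over_quadratic_sigma_additive.

End over_quadratic_measure.

(* The integrals are taken in the extended reals: with the library's
   conventions a product P_n P_m whose integral does not exist has integral
   different from 0, so orthogonality never holds by default. *)
Definition is_OPS (nu : {measure set (measurableTypeR R) -> \bar R})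
    (P : nat -> {poly R}) : Prop :=
  [/\ forall n, size (P n) = n.+1,
      forall n m, n <> m -> (\int[nu]_x ((P n).[x] * (P m).[x])%:E = 0)%E
    & forall n, (\int[nu]_x ((P n).[x] ^+ 2)%:E <> 0)%E].

Definition is_monic_OPS (nu : {measure set (measurableTypeR R) -> \bar R})
    (P : nat -> {poly R}) : Prop :=
  is_OPS nu P /\ forall n, P n \is monic.

(* The index n - 2 is shifted so that P_{-1} = P_{-2} = 0. *)
Definition quasi_orthogonal (P : nat -> {poly R}) (t : nat -> R) (n : nat) :
    {poly R} :=
  P n + t n *: (if n is m.+2 then P m else 0).

End borel_measures.

(* Main.v *)
From HB Require Import structures.
Require Import Defs.
From mathcomp Require Import all_boot all_order all_algebra.
From mathcomp Require Import all_classical all_reals all_analysis.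
From mathcomp Require Import measurable_realfun.

(* Write L and M for the integrals of polynomials against dmu / (c + x^2) and
   dmu, so that M(p) = L((c + x^2) p). By symmetry P_n has the parity of n,
   hence Q_0 = 1 and Q_1 = x.

   If the Q_n are orthogonal for L, pairing Q_n with Q_0 or Q_1 (according to
   the parity of n) gives J_n = - t_n J_(n-2), where J_n is the integral of P_n
   or x P_n. As J_0 = L(Q_0^2) and J_1 = L(Q_1^2) are nonzero and t_n <> 0, no
   J_n vanishes, and the formula follows.

   Conversely, the formula and t_n <> 0 give J_n <> 0, and L(Q_n) = L(x Q_n) = 0
   for n >= 2. Since x^2 = (c + x^2) - c,
   L(x^(k+2) Q_n) = M(x^k Q_n) - c L(x^k Q_n), so that L(x^k Q_n) = 0 for all
   k < n by induction on k, whereas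
   L(Q_n^2) = L(x^n Q_n) = M(x^(n-2) Q_n) = t_n M(P_(n-2)^2) <> 0. *)

Set Implicit Arguments.
Unset Strict Implicit.
Unset Printing Implicit Defensive.

Import Order.TTheory GRing.Theory Num.Theory.
Import numFieldNormedType.Exports.

Local Open Scope classical_set_scope.
Local Open Scope ring_scope.

(** * Reflected polynomials and expansion in monic families *)

Lemma coef_comp_polyNX (R : comNzRingType) (p : {poly R}) i :
  (p \Po (- 'X))`_i = (-1) ^+ i * p`_i.
Proof.
rewrite comp_polyE coef_sum.
under eq_bigr => j _ do
  rewrite -scaleN1r exprZn !coefZ coefXn mulrCA mulr_natr mulrb.
have [ip|pi] := ltnP i (size p); last first.
  rewrite big1 ?nth_default ?mulr0// => j _.
  by rewrite gtn_eqF ?mulr0// (leq_trans (ltn_ord j)).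
rewrite (bigD1 (Ordinal ip))//= eqxx big1 ?addr0// => j.
by rewrite -val_eqE/= eq_sym => /negbTE ->; rewrite mulr0.
Qed.

Lemma size_comp_polyNX (R : idomainType) (p : {poly R}) :
  size (p \Po (- 'X)) = size p.
Proof. by rewrite size_comp_poly2// size_polyN size_polyX. Qed.

Lemma size_subr_monic (R : nzRingType) (p q : {poly R}) n :
  (size p <= n.+1)%N -> size q = n.+1 -> q \is monic ->
  (size (p - p`_n *: q)%R <= n)%N.
Proof.
move=> sp sq /monicP; rewrite lead_coefE sq/= => q1.
apply/leq_sizeP => j; rewrite leq_eqVlt coefB coefZ => /predU1P[<-|nj].
  by rewrite q1 mulr1 subrr.
rewrite (nth_default 0 (leq_trans sp nj)) [q`_j]nth_default ?sq//.
by rewrite mulr0 subr0.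
Qed.

(** A monic family with one member in each degree spans: peeling off the top coefficient with
    [size_subr_monic] lowers the size. It serves both for the orthogonal family and for the
    monomials. *)
Lemma scalar_vanish (R : nzRingType) (B : nat -> {poly R}) (f : {poly R} -> R)
    n (p : {poly R}) :
  scalar f -> (forall k, size (B k) = k.+1) -> (forall k, B k \is monic) ->
  (forall k, (k < n)%N -> f (B k) = 0) -> (size p <= n)%N -> f p = 0.
Proof.
move=> f_lin sB mB.
elim: n p => [|n ihn] p fB sp.
  have /eqP -> : p == 0 by rewrite -size_poly_leq0.
  by have := f_lin (-1) 0 0; rewrite scaler0 addr0 mulN1r addNr.
rewrite -(subrK (p`_n *: B n) p) addrC f_lin fB// mulr0 add0r.
by apply: ihn => [k kn|]; [exact/fB/ltnW | exact: size_subr_monic].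
Qed.

(** * Orthogonality for a linear functional *)

Section orthogonal_polynomials.
Variables (F : fieldType) (M : {scalar {poly F}}) (P : nat -> {poly F}).
Hypotheses (sP : forall n, size (P n) = n.+1) (mP : forall n, P n \is monic).
Hypothesis orthP : forall n m, n <> m -> M (P n * P m) = 0.

Lemma orthogonal_lower n (p : {poly F}) : (size p <= n)%N -> M (P n * p) = 0.
Proof.
apply: (@scalar_vanish _ P (fun q => M (P n * q))) => // [a u v|k kn].
  by rewrite mulrDr -scalerAr linearP.
by apply: orthP => nk; rewrite nk ltnn in kn.
Qed.

Lemma orthogonal_leading n (p : {poly F}) : (size p <= n.+1)%N ->
  M (P n * p) = p`_n * M (P n * P n).
Proof.
move=> sp; rewrite -[in LHS](subrK (p`_n *: P n) p) mulrDr linearD/=.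
rewrite (orthogonal_lower (size_subr_monic sp (sP n) (mP n))) add0r.
by rewrite -scalerAr linearZ.
Qed.

Hypothesis normP : forall n, M (P n ^+ 2) != 0.
Hypothesis M_even : forall p, M (p \Po (- 'X)) = M p.

(** This is uniqueness of the monic orthogonal polynomial: the reflected [P n] is, up to sign, monic
    of the same degree and, as [M] is even, orthogonal to all lower degrees. *)
Lemma orthogonal_parity n : P n \Po (- 'X) = (-1) ^+ n *: P n.
Proof.
pose D := P n \Po (- 'X) - (-1) ^+ n *: P n.
apply/eqP; rewrite -subr_eq0 -/D; apply: contraT => D_neq0.
have sD : (size D <= n)%N.
  have := @size_subr_monic _ (P n \Po (- 'X)) (P n) n.
  rewrite size_comp_polyNX sP coef_comp_polyNX => /(_ (leqnn _) erefl (mP n)).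
  by have /monicP := mP n; rewrite lead_coefE sP/= => ->; rewrite mulr1.
have orthD (p : {poly F}) : (size p <= n)%N -> M (D * p) = 0.
  move=> sp; rewrite mulrBl linearB/= -scalerAl linearZ/= orthogonal_lower//.
  rewrite mulr0 subr0 -M_even comp_polyM -comp_polyA.
  rewrite raddfN/= comp_polyX opprK comp_polyXr.
  by rewrite orthogonal_lower ?size_comp_polyNX.
have [k sDk] : exists k, size D = k.+1.
  by exists (size D).-1; rewrite prednK// size_poly_gt0.
(* With [k] the degree of [D], this pairing is the leading coefficient of [D] times the nonzero norm
   of [P k]. *)
have := orthD (P k); rewrite sP -sDk => /(_ sD) /eqP.
rewrite mulrC orthogonal_leading ?sDk// mulf_eq0 (negPf (normP k)) orbF.
by have := lead_coef_eq0 D; rewrite lead_coefE sDk/= (negPf D_neq0) => ->.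
Qed.

End orthogonal_polynomials.

(** * Quasi-orthogonal polynomials and their coefficients *)

Section quasi_orthogonal_monic.
Variables (F : nzRingType) (P Q : nat -> {poly F}) (t : nat -> F).
Hypotheses (sP : forall n, size (P n) = n.+1) (mP : forall n, P n \is monic).
Hypotheses (Q0 : Q 0%N = P 0%N) (Q1 : Q 1%N = P 1%N).
Hypothesis QE : forall n, Q n.+2 = P n.+2 + t n.+2 *: P n.

Lemma size_quasi_orthogonal n : size (Q n) = n.+1.
Proof.
case: n => [|[|n]]; rewrite ?Q0 ?Q1// QE size_polyDl sP//.
by rewrite (leq_ltn_trans (size_scale_leq _ _))// sP.
Qed.

Lemma quasi_orthogonal_monic n : Q n \is monic.
Proof.
case: n => [|[|n]]; rewrite ?Q0 ?Q1// QE monicE lead_coefDl -?monicE// sP.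
by rewrite (leq_ltn_trans (size_scale_leq _ _))// sP.
Qed.

End quasi_orthogonal_monic.

(** With this factor, the even and odd cases of the coefficient formula become one expression. *)
Definition parity_monomial (R : nzRingType) n : {poly R} :=
  if odd n then 'X else 1.

Section quasi_orthogonal.
Variables (F : numFieldType) (L M : {scalar {poly F}}) (c : F).
Variables (P Q : nat -> {poly F}) (t : nat -> F).
Hypothesis ML : forall p, M p = L (('X^2 + c%:P) * p).
Hypotheses (L_even : forall p, L (p \Po (- 'X)) = L p).
Hypotheses (sP : forall n, size (P n) = n.+1) (mP : forall n, P n \is monic).
Hypothesis orthP : forall n m, n <> m -> M (P n * P m) = 0.
Hypothesis normP : forall n, M (P n ^+ 2) != 0.
Hypothesis t_neq0 : forall n, t n.+2 != 0.
Hypotheses (Q0 : Q 0%N = P 0%N) (Q1 : Q 1%N = P 1%N).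
Hypothesis QE : forall n, Q n.+2 = P n.+2 + t n.+2 *: P n.

Let M_even p : M (p \Po (- 'X)) = M p.
Proof.
rewrite !ML -L_even comp_polyM -comp_polyA comp_polyD comp_polyC rmorphXn/=.
by rewrite comp_polyX sqrrN raddfN/= comp_polyX opprK comp_polyXr.
Qed.

Let parityP n : P n \Po (- 'X) = (-1) ^+ n *: P n.
Proof. exact: (orthogonal_parity sP mP orthP normP M_even). Qed.

Let L_odd p : p \Po (- 'X) = - p -> L p = 0.
Proof.
move=> pN; have /eqP : L p *+ 2 = 0.
  by rewrite mulr2n -{1}L_even pN linearN addNr.
by rewrite mulrn_eq0 => /eqP.
Qed.

Let P0 : P 0%N = 1.
Proof.
have /monicP := mP 0; have /eqP := sP 0.
by move=> /size_poly1P[a _ ->]; rewrite lead_coefC => ->.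
Qed.

Let P1 : P 1%N = 'X.
Proof.
have := mP 1; rewrite monicE lead_coefE sP/= => /eqP lc.
apply/polyP => -[|[|i]]; rewrite coefX//=; last first.
  by rewrite nth_default ?sP.
(* Oddness of [P 1] makes its constant coefficient equal to its own negative. *)
have := congr1 (fun p : {poly F} => p`_0) (parityP 1%N).
rewrite coef_comp_polyNX expr0 mul1r expr1 scaleN1r coefN => /eqP.
by rewrite -addr_eq0 -mulr2n mulrn_eq0/= => /eqP.
Qed.

Local Notation pairing n := (L (parity_monomial F n * P n)).

(** The boolean [odd n] is read as the index 0 or 1, so pairing with the monomial is an instance of
    orthogonality of the [Q n]. *)
Let parity_monomialE n : parity_monomial F n = Q (odd n).
Proof. by rewrite /parity_monomial; case: odd; rewrite ?Q0 ?Q1 ?P0 ?P1. Qed.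

Let L_monomialQ n : L (parity_monomial F n * Q n.+2) =
  pairing n.+2 + t n.+2 * pairing n.
Proof.
rewrite QE mulrDr linearD/= -scalerAr linearZ/= /parity_monomial.
by rewrite /= negbK.
Qed.

Lemma quasi_orthogonal_coefficients :
  (forall n m, n <> m -> L (Q n * Q m) = 0) ->
  (forall n, L (Q n ^+ 2) != 0) ->
  forall n, t n.+2 = - pairing n.+2 / pairing n.
Proof.
move=> orthQ normQ.
have tE n : pairing n.+2 = - (t n.+2 * pairing n).
  apply/eqP; rewrite -addr_eq0 -L_monomialQ parity_monomialE orthQ//.
  by case: odd.
have pairing_neq0 n : pairing n != 0.
  (* The recurrence [tE] jumps by two, hence an induction on two consecutive indices. *)
  suff /andP[] : (pairing n != 0) && (pairing n.+1 != 0) by [].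
  elim: n => [|n /andP[ih0 ih1]].
    rewrite /parity_monomial/= mul1r P0.
    have := normQ 0%N; have := normQ 1%N.
    by rewrite Q0 Q1 P0 P1 expr1n expr2 => -> ->.
  by rewrite ih1/= tE oppr_eq0 mulf_neq0.
by move=> n; rewrite tE opprK mulfK.
Qed.

Let parityQ n : Q n \Po (- 'X) = (-1) ^+ n *: Q n.
Proof.
case: n => [|[|n]]; rewrite ?Q0 ?Q1 ?parityP// QE comp_polyD comp_polyZ.
by rewrite !parityP !exprS mulrA mulrNN !mul1r scalerDr !scalerA mulrC.
Qed.

Let sQ := size_quasi_orthogonal sP Q0 Q1 QE.

Let mQ := quasi_orthogonal_monic sP mP Q0 Q1 QE.

Lemma quasi_orthogonal_orthogonal :
  (forall n, t n.+2 = - pairing n.+2 / pairing n) ->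
  (forall n m, n <> m -> L (Q n * Q m) = 0) /\
  (forall n, L (Q n ^+ 2) != 0).
Proof.
move=> tE.
(* Inversion sends 0 to 0, so a zero numerator or denominator in [tE] would make [t n.+2] zero. *)
have pairing_neq0 n : pairing n != 0.
  by have := t_neq0 n; rewrite tE; apply: contraNneq => ->; rewrite invr0 mulr0.
have LXX p : L ('X^2 * p) = M p - c * L p.
  by rewrite ML mulrDl linearD/= mul_polyC linearZ/= addrK.
(* [P n.+2] is orthogonal to ['X^j], so only [t n.+2 *: P n] contributes, and only for [j = n]. *)
have MQ j n : (j <= n)%N ->
    M ('X^j * Q n.+2) = (j == n)%:R * (t n.+2 * M (P n * P n)).
  move=> jn; rewrite QE mulrC mulrDl linearD/= orthogonal_lower//; last first.
    by rewrite size_polyXn (leq_trans _ (leqnSn _)).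
  rewrite add0r -scalerAl linearZ/= (orthogonal_leading sP)//.
    by rewrite coefXn eq_sym mulrCA.
  by rewrite size_polyXn.
have LQ n k : (k < n)%N -> L ('X^k * Q n) = 0.
  (* The step goes from [k] to [k.+2]. For [k] equal to 0 or 1 and index [n.+2], the product is
     either odd, hence killed by [L_odd], or covered by the coefficient formula. *)
  elim/ltn_ind: k n => -[|[|k]] ih [|[|n]]//.
  - by rewrite expr0 mul1r Q1 L_odd// parityP expr1 scaleN1r.
  - rewrite expr0 mul1r => _; have [n_odd|n_even] := boolP (odd n).
      by rewrite L_odd// parityQ -signr_odd/= negbK n_odd expr1 scaleN1r.
    have := L_monomialQ n; rewrite tE divfK// subrr /parity_monomial.
    by rewrite (negPf n_even) mul1r.
  - rewrite expr1 => _; have [n_odd|n_even] := boolP (odd n).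
      have := L_monomialQ n; rewrite tE divfK// subrr /parity_monomial.
      by rewrite n_odd.
    rewrite L_odd// comp_polyM comp_polyX parityQ -signr_odd/= negbK.
    by rewrite (negPf n_even) expr0 scale1r mulNr.
  - rewrite !ltnS => kn.
    rewrite -addn2 addnC exprD -mulrA LXX MQ 1?ltnW// ltn_eqF// mul0r.
    by rewrite ih ?mulr0 ?subrr// ltnW// ltnW.
have L_lower n (p : {poly F}) : (size p <= n)%N -> L (p * Q n) = 0.
  apply: (@scalar_vanish _ (fun k => 'X^k) (fun q => L (q * Q n))).
  - by move=> a u v; rewrite mulrDl -scalerAl linearP.
  - by move=> k; rewrite size_polyXn.
  - by move=> k; rewrite monicXn.
  - exact: LQ.
split=> [n m /eqP|n].
  rewrite neq_ltn => /orP[nm|mn]; first by rewrite L_lower ?sQ.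
  by rewrite mulrC L_lower ?sQ.
(* Both [Q n] and ['X^n] are monic of degree [n], so their difference is orthogonal to [Q n]. *)
have -> : L (Q n ^+ 2) = L ('X^n * Q n).
  apply/esym/eqP; rewrite -subr_eq0 -linearB/= expr2 -mulrBl L_lower//.
  have := @size_subr_monic _ 'X^n (Q n) n.
  by rewrite size_polyXn coefXn eqxx scale1r; apply.
case: n => [|[|n]].
(* For [n] equal to 0 or 1 the norm is the pairing itself. *)
- by have := pairing_neq0 0%N; rewrite Q0.
- by have := pairing_neq0 1%N; rewrite Q1.
rewrite -addn2 addnC exprD -mulrA LXX LQ ?ltnS ?(leqnSn n)// mulr0 subr0.
by rewrite MQ// eqxx mul1r mulf_neq0// -expr2.
Qed.

End quasi_orthogonal.

(** * Integration against a measure with a density *)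

Section as_finite_measure.
Context d (T : measurableType d) (R : realType).
Variables (mu : {measure set T -> \bar R}) (mu_fin : fin_num_fun mu).

(** A copy of [mu] that carries the finiteness proof as an argument, so that the finite measure
    structure can be inferred. *)
Definition as_finite_measure of fin_num_fun mu : set T -> \bar R := mu.

HB.instance Definition _ := Measure.on (as_finite_measure mu_fin).
HB.instance Definition _ :=
  Measure_isFinite.Build d T R (as_finite_measure mu_fin) mu_fin.

End as_finite_measure.

Section integral_density.
Context d (T : measurableType d) (R : realType).
Variables (mu : {sigma_finite_measure set T -> \bar R}).
Variables (nu : {finite_measure set T -> \bar R}) (w : T -> \bar R).
Hypothesis mw : mu.-integrable setT w.
Hypothesis nuE : forall A, measurable A -> nu A = (\int[mu]_(x in A) w x)%E.

(** The Radon-Nikodym derivative of [nu] and the density [w] have the same integral over every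
    measurable set, hence agree almost everywhere. *)
Lemma integral_density f : nu.-integrable setT f ->
  (\int[nu]_x f x = \int[mu]_x (f x * w x))%E.
Proof.
move=> intf.
have numu : nu `<< mu.
  apply/null_content_dominatesP => A mA muA0; rewrite nuE//.
  by rewrite null_set_integral//; exact/measurable_funTS/(measurable_int mu).
rewrite -(Radon_Nikodym_change_of_variables numu)//.
apply: ae_eq_integral => //.
- apply: emeasurable_funM; first exact: measurable_int intf.
  exact: (measurable_int mu (Radon_Nikodym_integrable _)).
- apply: emeasurable_funM; first exact: measurable_int intf.
  exact: measurable_int mw.
- apply: ae_eqe_mul2l; apply: integral_ae_eq => //.
  + exact: Radon_Nikodym_integrable.
  + exact: measurable_int mw.
  + by move=> E _ mE; rewrite -Radon_Nikodym_integral//= -nuE.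
Qed.
End integral_density.

(** * Polynomial integrals as linear functionals, and the measure with density [(c + x ^+ 2)^-1] *)

Section moments.
Context {R : realType}.
Implicit Type mu : {measure set (measurableTypeR R) -> \bar R}.

Lemma integrable_horner mu (p : {poly R}) : finite_moments mu ->
  mu.-integrable setT (fun x : R => (p.[x])%:E).
Proof.
move=> mom; under eq_fun do rewrite horner_coef -sumEFin.
apply: (@integrable_sum _ _ _ mu setT _ _ _ _
  (fun i x => (p`_(nat_of_ord i) * x ^+ i)%:E)) => // i _.
by under eq_fun do rewrite EFinM; exact: integrableZl.
Qed.

(* The moment hypothesis is an argument so that the linear structure, which
   depends on it, can be inferred. *)
Definition poly_integral mu of finite_moments mu := fun p : {poly R} =>
  \int[mu]_x p.[x].

Lemma integral_horner mu (mom : finite_moments mu) (p : {poly R}) :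
  (\int[mu]_x (p.[x])%:E)%E = (poly_integral mom p)%:E.
Proof.
by rewrite /poly_integral /Rintegral fineK// integrable_fin_num//;
  exact: integrable_horner.
Qed.

Section linearity.
Variables (mu : {measure set (measurableTypeR R) -> \bar R}).
Variable mom : finite_moments mu.

Let poly_integral_linear : scalar (poly_integral mom).
Proof.
move=> a p q; rewrite /poly_integral.
under eq_Rintegral do rewrite hornerD hornerZ.
rewrite RintegralD//; last 2 first.
- by have := integrable_horner (a *: p) mom; under eq_fun do rewrite hornerZ.
- exact: integrable_horner.
by rewrite RintegralZl//; exact: integrable_horner.
Qed.

HB.instance Definition _ :=
  GRing.isLinear.Build R {poly R} R _ (poly_integral mom) poly_integral_linear.
End linearity.

Lemma symmetric_integral mu (f : R -> \bar R) : symmetric_measure mu ->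
  measurable_fun setT f -> mu.-integrable setT (f \o -%R) ->
  (\int[mu]_x f (- x)%R = \int[mu]_x f x)%E.
Proof.
move=> mu_sym mf intf.
pose opp : measurableTypeR R -> measurableTypeR R := -%R.
have mopp : measurable_fun setT opp by exact: oppr_measurable.
transitivity (\int[pushforward mu opp]_x f x)%E.
  by rewrite (integral_pushforward mopp mf).
by apply: eq_measure_integral => A mA _; exact: mu_sym.
Qed.

Lemma poly_integral_symmetric mu (mom : finite_moments mu) (p : {poly R}) :
  symmetric_measure mu ->
  poly_integral mom (p \Po (- 'X)) = poly_integral mom p.
Proof.
move=> mu_sym; apply: EFin_inj; rewrite -!integral_horner.
have E x : (p \Po (- 'X)).[x] = p.[- x] by rewrite horner_comp hornerN hornerX.
rewrite -(symmetric_integral (f := fun x => (p.[x])%:E))//.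
- by under eq_integral do rewrite E.
- exact: (measurable_int mu (integrable_horner p mom)).
- rewrite [X in mu.-integrable _ X](_ : _ = (fun x => ((p \Po (- 'X)).[x])%:E)).
    exact: integrable_horner.
  by apply/funext => x /=; rewrite E.
Qed.

Section over_quadratic.
Variables (mu : {measure set (measurableTypeR R) -> \bar R}).
Variables (c : R) (c_gt0 : 0 < c) (mom : finite_moments mu).
Local Notation nu := (over_quadratic mu c_gt0).
Local Notation w := (fun x : R => ((c + x ^+ 2)^-1)%:E).

Let mw : measurable_fun [set: measurableTypeR R] w.
Proof.
apply/measurable_EFinP; have cw : continuous (fun x : R => (c + x ^+ 2)^-1).
  move=> x; apply: cvgV; first by rewrite gt_eqF// ltr_pwDl ?sqr_ge0.
  by apply: cvgD; [exact: cvg_cst | exact: exprn_continuous].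
exact: continuous_measurable_fun cw.
Qed.

Let w_ge0 x : (0 <= w x)%E.
Proof. by rewrite lee_fin invr_ge0 addr_ge0 ?sqr_ge0// ltW. Qed.

Let w_le x : (w x <= c^-1%:E)%E.
Proof. by rewrite lee_fin lef_pV2 ?posrE ?lerDl ?ltr_pwDl ?sqr_ge0. Qed.

Let mu_fin : fin_num_fun mu.
Proof.
apply: lty_fin_num_fun.
(* The zeroth moment is the total mass. *)
have := mom 0; under eq_fun do rewrite expr0.
move=> /integrableP[_]; under eq_integral do rewrite abse1.
by rewrite integral_cst// mul1e.
Qed.

Let cV : {nonneg R} := NngNum (ltW (etrans (invr_gt0 c) c_gt0)).

(** The density is at most [c^-1]; this bound transfers finiteness and moments from [mu] to [nu]. *)
Let nu_le A : measurable A -> (nu A <= mscale cV mu A)%E.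
Proof.
move=> mA; rewrite /mscale/= -integral_cst// ge0_le_integral//.
exact: measurable_funTS.
Qed.

Lemma over_quadratic_moments : finite_moments nu.
Proof.
move=> n; have /integrableP[mX Xoo] := mom n; apply/integrableP; split => //.
apply: le_lt_trans (ge0_le_measure_integral nu_le _ _ _) _ => //.
  exact: measurableT_comp.
rewrite ge0_integral_mscale//; first by rewrite lte_mul_pinfty.
exact: measurableT_comp.
Qed.

(** The density is even, so the reflection can be moved onto [mu]. *)
Lemma over_quadratic_symmetric : symmetric_measure mu -> symmetric_measure nu.
Proof.
move=> mu_sym A mA; rewrite /over_quadratic.
pose opp : measurableTypeR R -> measurableTypeR R := -%R.
have mopp : measurable_fun setT opp by exact: oppr_measurable.
transitivity (\int[pushforward mu opp]_(x in A) w x)%E.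
  rewrite (ge0_integral_pushforward mopp)//; last exact: measurable_funTS.
  by apply: eq_integral => x _ /=; rewrite sqrrN.
by apply: eq_measure_integral => B mB _; exact: mu_sym.
Qed.

(** The factor ['X^2 + c%:P] cancels the density pointwise; both measures are finite, so
    [integral_density] applies. *)
Lemma poly_integral_over_quadratic (p : {poly R}) :
  poly_integral mom p =
  poly_integral over_quadratic_moments (('X^2 + c%:P) * p).
Proof.
apply: EFin_inj; rewrite -!integral_horner.
have nu_fin : fin_num_fun nu.
  move=> A mA; rewrite ge0_fin_numE// (le_lt_trans (nu_le mA))//.
  by rewrite lte_mul_pinfty// ltey_eq mu_fin.
have intw : (as_finite_measure mu_fin).-integrable setT w.
  apply: (@le_integrable _ _ _ _ _ measurableT _ (cst c^-1%:E)) => //.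
    by move=> x _; rewrite !gee0_abs// lee_fin invr_ge0 ltW.
  exact: finite_measure_integrable_cst.
rewrite (@integral_density _ _ _ (as_finite_measure mu_fin)
  (as_finite_measure nu_fin) w)//; last first.
  exact: integrable_horner over_quadratic_moments.
apply: eq_integral => x _; rewrite -EFinM hornerM hornerD hornerXn hornerC.
by rewrite addrC mulrAC divff ?mul1r// gt_eqF// ltr_pwDl ?sqr_ge0.
Qed.

End over_quadratic.
End moments.

Theorem theorem4p1 (R : realType)
    (mu : {measure set (measurableTypeR R) -> \bar R})
    (mu_sym : symmetric_measure mu)
    (mu_moments : finite_moments mu)
    (supp_sym : symmetric_set (measure_support mu))
    (supp_inf : infinite_set (measure_support mu))
    (c : R) (c_gt0 : 0 < c)
    (P : nat -> {poly R}) (P_OPS : is_monic_OPS mu P)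
    (t : nat -> R) (t0 : t 0%N = 0) (t1 : t 1%N = 0)
    (t_neq0 : forall n : nat, (2 <= n)%N -> t n <> 0) :
  is_monic_OPS (over_quadratic mu c_gt0) (quasi_orthogonal P t) <->
  (forall n : nat, (2 <= n)%N ->
     t n =
       if odd n then
         - (\int[over_quadratic mu c_gt0]_x (x * (P n).[x]))
         / (\int[over_quadratic mu c_gt0]_x (x * (P (n - 2)%N).[x]))
       else
         - (\int[over_quadratic mu c_gt0]_x (P n).[x])
         / (\int[over_quadratic mu c_gt0]_x (P (n - 2)%N).[x])).
Proof.
have momn := over_quadratic_moments c_gt0 mu_moments.
have nu_sym := over_quadratic_symmetric c_gt0 mu_sym.
set nu := over_quadratic mu c_gt0 in momn nu_sym *.
have [[sP orthP normP] mP] := P_OPS.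
pose M := poly_integral mu_moments; pose L := poly_integral momn.
(* Finite moments turn the extended-real integrals of the definition into values of the linear
   functional. *)
have prodE (rho : {measure set (measurableTypeR R) -> \bar R})
    (mom : finite_moments rho) (p q : {poly R}) :
    (\int[rho]_x (p.[x] * q.[x])%:E = (poly_integral mom (p * q))%:E)%E.
  by rewrite -integral_horner; under [RHS]eq_integral do rewrite hornerM.
have orthM n m : n <> m -> M (P n * P m) = 0.
  by move=> /orthP; rewrite (prodE _ mu_moments) => -[].
have normM n : M (P n ^+ 2) != 0.
  apply/eqP => M0; apply: (normP n); under eq_integral do rewrite expr2.
  by rewrite (prodE _ mu_moments) -expr2 -/M M0.
have ML p : M p = L (('X^2 + c%:P) * p).
  exact: (poly_integral_over_quadratic c_gt0).
have L_even p : L (p \Po (- 'X)) = L p by exact: poly_integral_symmetric.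
pose Q := quasi_orthogonal P t.
have Q0 : Q 0%N = P 0%N by rewrite /Q /quasi_orthogonal scaler0 addr0.
have Q1 : Q 1%N = P 1%N by rewrite /Q /quasi_orthogonal scaler0 addr0.
have QE n : Q n.+2 = P n.+2 + t n.+2 *: P n by [].
have t_neq n : t n.+2 != 0 by apply/eqP/t_neq0.
have coefE n : (if odd n.+2 then
         - (\int[nu]_x (x * (P n.+2).[x]))
         / (\int[nu]_x (x * (P (n.+2 - 2)%N).[x]))
       else
         - (\int[nu]_x (P n.+2).[x])
         / (\int[nu]_x (P (n.+2 - 2)%N).[x])) =
    - L (parity_monomial R n.+2 * P n.+2) / L (parity_monomial R n * P n).
  rewrite subn2/= negbK /parity_monomial /= negbK.
  case: odd; last by rewrite !mul1r.
  by rewrite /L /poly_integral; congr (- _ / _);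
    apply: eq_Rintegral => x _; rewrite hornerM hornerX.
have coef := @quasi_orthogonal_coefficients _ L M c P Q t ML L_even sP mP
  orthM normM t_neq Q0 Q1 QE.
have orth := @quasi_orthogonal_orthogonal _ L M c P Q t ML L_even sP mP
  orthM normM t_neq Q0 Q1 QE.
split=> [[[_ orthQ normQ] _] [|[|n]]// _|tE].
  rewrite coefE; apply: coef => [k m /orthQ|k].
    by rewrite (prodE _ momn) => -[].
  apply/eqP => L0; apply: (normQ k); under eq_integral do rewrite expr2.
  by rewrite (prodE _ momn) -expr2; exact: (congr1 EFin L0).
have {}orth := orth (fun n => etrans (tE n.+2 isT) (coefE n)).
split; last exact: (quasi_orthogonal_monic sP mP Q0 Q1 QE).
split; first exact: (size_quasi_orthogonal sP Q0 Q1 QE).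
- by move=> n m nm; rewrite (prodE _ momn) orth.1.
- move=> n; under eq_integral do rewrite expr2.
  by rewrite (prodE _ momn) -expr2 => -[] /eqP; apply/negP; exact: orth.2.
Qed.
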